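(* Assume analytic determinacy. Let $(e_n)_{n=1}^\infty$ be a sequence of non-zero vectors in a Banach lattice $X$ with $X=[e_n]$. The following conditions are equivalent: (1) $(e_n)$ is a $\sigma$-order basis for $X$; (2) $(e_n)$ is a uniform basis for $X$ such that $0=^{\sigma o}\sum_{n=1}^\infty 0\,e_n$ is the unique $\sigma$-order expansion of $0$; that is, if $(a_n)\in\mathbb R^{\mathbb N}$ and $0=^{\sigma o}\sum_{n=1}^\infty a_ne_n$, then $a_n=0$ for all $n$.
   Context: All Banach lattices are real. $[e_n]$ denotes the norm-closed linear span of $(e_n)$. For a sequence $(x_n)$ and a vector $x$ in a Banach lattice $X$: $x_n$ converges uniformly to $x$ if there is $z\in X_+$ such that for every $m$, $|x_n-x|\le\frac zm$ for all but finitely many $n$; $x_n$ $\sigma$-order converges to $x$ if there is a sequence $(z_m)$ in $X$, decreasing with infimum $0$ in $X$, such that for every $m$, $|x_n-x|\le z_m$ for all but finitely many $n$. Write $x=^{\sigma o}\sum_{n=1}^\infty x_n$ if the partial sums of the series $\sigma$-order converge to $x$. A sequence $(e_n)$ is a $\sigma$-order (respectively uniform) basis for $X$ if for every $x\in X$ there is a unique $(a_n)\in\mathbb R^{\mathbb N}$ such that the partial sums $\sum_{n=1}^m a_ne_n$ $\sigma$-order converge (respectively converge uniformly) to $x$. Analytic determinacy is the axiom that for every analytic ($\mathbf\Sigma^1_1$) set $A\subseteq\mathbb N^{\mathbb N}$ the infinite two-player game on $\mathbb N$ with payoff set $A$ is determined, i.e. one of the players has a winning strategy. *)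

(* Defs.v *)
From HB Require Import structures.
From mathcomp Require Import all_boot all_order all_algebra.
From mathcomp Require Import all_classical all_reals all_analysis.
Set Implicit Arguments.
Unset Strict Implicit.
Unset Printing Implicit Defensive.
Import Order.TTheory GRing.Theory Num.Theory.
Import numFieldNormedType.Exports.
Local Open Scope classical_set_scope.
Local Open Scope ring_scope.

Reserved Notation "x <=v y" (at level 70, y at next level).

(* MathComp's order hierarchy already joins its lattices with its zmodules,
   in totally ordered domains, so that no structure joining latticeType with
   lmodType can be added to it: the vector lattice order is therefore declared
   with its own operations. *)
HB.mixin Record isVectorLattice (R : realType) X of GRing.Lmodule R X := {
  lev : rel X ;
  joinv : X -> X -> X ;
  meetv : X -> X -> X ;
  lev_refl : reflexive lev ;
  lev_anti : antisymmetric lev ;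
  lev_trans : transitive lev ;
  levUx : forall x y z, lev (joinv x y) z = lev x z && lev y z ;
  levxI : forall x y z, lev z (meetv x y) = lev z x && lev z y ;
  lev_wD2r : forall z x y, lev x y -> lev (x + z) (y + z) ;
  scalev_ge0 : forall (a : R) x, 0 <= a -> lev 0 x -> lev 0 (a *: x)
}.

#[short(type="vectorLatticeType")]
HB.structure Definition VectorLattice (R : realType) :=
  { X of GRing.Lmodule R X & isVectorLattice R X }.

Notation "x <=v y" := (lev x y) : ring_scope.

(* The modulus |x|; the notation `|x| is the norm. *)
Definition modulus (R : realType) (X : vectorLatticeType R) (x : X) : X :=
  joinv x (- x).

HB.mixin Record isBanachLattice (R : realType) X
    of CompleteNormedModule R X & VectorLattice R X := {
  ler_norm_modulus : forall x y : X, modulus x <=v modulus y -> `|x| <= `|y|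
}.

#[short(type="banachLatticeType")]
HB.structure Definition BanachLattice (R : realType) :=
  { X of CompleteNormedModule R X & VectorLattice R X
       & isBanachLattice R X }.

Section Convergence.
Context {R : realType} {X : banachLatticeType R}.
Implicit Types (u : nat -> X) (x : X) (e : nat -> X) (a : nat -> R).

Definition uniform_cvg u x :=
  exists2 z : X, 0 <=v z &
    forall m : nat, (0 < m)%N ->
      \forall n \near \oo, modulus (u n - x) <=v m%:R^-1 *: z.

Definition sigma_order_cvg u x :=
  exists z : nat -> X,
    [/\ forall m, z m.+1 <=v z m,
        forall m, 0 <=v z m,
        forall w, (forall m, w <=v z m) -> w <=v 0 &
        forall m, \forall n \near \oo, modulus (u n - x) <=v z m].

(* Sequences are indexed from 0, and [series f n] is the sum of the first n
   terms of f; the extra empty sum is irrelevant to convergence. *)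
Definition sigma_order_expansion e a x :=
  sigma_order_cvg (series (fun k => a k *: e k)) x.

Definition uniform_expansion e a x :=
  uniform_cvg (series (fun k => a k *: e k)) x.

Definition sigma_order_basis e :=
  forall x, exists! a, sigma_order_expansion e a x.

Definition uniform_basis e := forall x, exists! a, uniform_expansion e a x.

Definition closed_span e : set X :=
  closure [set x | exists n a, x = \sum_(k < n) a k *: e k].

End Convergence.

Notation baire := {ptws nat -> nat}.

(* Boldface Sigma^1_1: projections of closed subsets of the plane. *)
Definition analytic (A : set baire) :=
  exists2 C : set (baire * baire), closed C & A = fst @` C.

(* In the game with payoff set A, player I chooses x 0, x 2, x 4 ... and
   player II chooses x 1, x 3, x 5 ...; I wins when x is in A. A strategy
   maps the finite sequence of all moves made so far to the next move. *)
Definition strategy := seq nat -> nat.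

Definition follows_I (s : strategy) (x : baire) :=
  forall k : nat, x k.*2 = s (mkseq x k.*2).

Definition follows_II (s : strategy) (x : baire) :=
  forall k : nat, x k.*2.+1 = s (mkseq x k.*2.+1).

Definition winning_I (A : set baire) (s : strategy) :=
  forall x : baire, follows_I s x -> A x.

Definition winning_II (A : set baire) (s : strategy) :=
  forall x : baire, follows_II s x -> ~ A x.

Definition determined (A : set baire) :=
  (exists s, winning_I A s) \/ (exists s, winning_II A s).

Definition analytic_determinacy := forall A : set baire,
  analytic A -> determined A.

(* Main.v *)
Require Import Defs.
From mathcomp Require Import all_boot all_order all_algebra.
From mathcomp Require Import all_classical all_reals all_analysis.
From mathcomp Require Import ring lra.
Set Implicit Arguments.
Unset Strict Implicit.
Unset Printing Implicit Defensive.
Import Order.TTheory GRing.Theory Num.Theory.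
Import numFieldNormedType.Exports.
Local Open Scope classical_set_scope.
Local Open Scope ring_scope.

(** The sequences a whose partial sums S_n(a) = sum_(k < n) a_k e_k satisfy
    |S_n(a)| <= w for some w form a Banach space under the infimum of the norms
    of such w, and those whose partial sums sigma-order converge form a closed
    subspace of it.  For a sigma-order basis, sending a to its sum is a
    continuous bijection of this subspace onto X, so the open mapping theorem
    (here run by hand, from the Baire category theorem) bounds all the partial
    sums of x by some w with ||w|| <= M ||x||.  Approximating x by finite sums
    y_k with ||x - y_k|| <= 4^-k, the partial sums of x - y_k are bounded by
    some w_k with ||w_k|| <= M 4^-k, and |S_n(x) - x| <= w_k + |x - y_k| for n
    large; the series of the 2^k (w_k + |x - y_k|) is the regulator of the
    uniform convergence. *)

(** * Order arithmetic and the modulus in a vector lattice *)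

Section VectorLatticeTheory.
Variables (R : realType) (X : vectorLatticeType R).
Implicit Types (x y z w : X) (t : R).

Lemma lev_wD2l z x y : x <=v y -> z + x <=v z + y.
Proof. by rewrite ![z + _]addrC; exact: lev_wD2r. Qed.

Lemma levD x y z w : x <=v y -> z <=v w -> x + z <=v y + w.
Proof. by move=> xy zw; apply: lev_trans (lev_wD2l y zw); exact: lev_wD2r. Qed.

Lemma subv_ge0 x y : (0 <=v y - x) = (x <=v y).
Proof.
apply/idP/idP => [/(lev_wD2r x _ _)|/(lev_wD2r (- x) _ _)].
  by rewrite add0r subrK.
by rewrite subrr.
Qed.

Lemma levN2 x y : (- x <=v - y) = (y <=v x).
Proof. by rewrite -subv_ge0 opprK addrC subv_ge0. Qed.

Lemma lev_subl_addr x y z : (x - y <=v z) = (x <=v z + y).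
Proof. by rewrite -subv_ge0 opprB addrA subv_ge0. Qed.

Lemma subv_le0 x y : (x - y <=v 0) = (x <=v y).
Proof. by rewrite lev_subl_addr add0r. Qed.

Lemma lev_wpZ2l t x y : 0 <= t -> x <=v y -> t *: x <=v t *: y.
Proof.
move=> t0; rewrite -subv_ge0 => /(scalev_ge0 _ _ t0).
by rewrite scalerBr subv_ge0.
Qed.

Lemma lev_wpZ2r x t t' : 0 <=v x -> t <= t' -> t *: x <=v t' *: x.
Proof.
by move=> x0 tt'; rewrite -subv_ge0 -scalerBl scalev_ge0// subr_ge0.
Qed.

Lemma joinv_ubl x y : x <=v joinv x y.
Proof. by have := lev_refl (joinv x y); rewrite levUx => /andP[]. Qed.

Lemma joinv_ubr x y : y <=v joinv x y.
Proof. by have := lev_refl (joinv x y); rewrite levUx => /andP[]. Qed.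

Lemma meetv_lbl x y : meetv x y <=v x.
Proof. by have := lev_refl (meetv x y); rewrite levxI => /andP[]. Qed.

Lemma meetv_lbr x y : meetv x y <=v y.
Proof. by have := lev_refl (meetv x y); rewrite levxI => /andP[]. Qed.

Lemma lev_modulus x z : (modulus x <=v z) = (x <=v z) && (- x <=v z).
Proof. exact: levUx. Qed.

Lemma ler_modulus x : x <=v modulus x.
Proof. exact: joinv_ubl. Qed.

(** Half of the inequality 0 = x - x <= |x| + |x|. *)
Lemma modulus_ge0 x : 0 <=v modulus x.
Proof.
have : 0 <=v modulus x + modulus x.
  by rewrite -(subrr x); apply: levD; [exact: joinv_ubl|exact: joinv_ubr].
have half0 : 0 <= 2^-1 :> R by rewrite invr_ge0.
rewrite -mulr2n -scaler_nat => /(lev_wpZ2l half0).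
by rewrite scaler0 scalerA mulVf ?pnatr_eq0// scale1r.
Qed.

Lemma modulusN x : modulus (- x) = modulus x.
Proof.
by apply: lev_anti; rewrite !lev_modulus /modulus !opprK !joinv_ubl !joinv_ubr.
Qed.

Lemma ge0_modulus x : 0 <=v x -> modulus x = x.
Proof.
move=> x0; apply: lev_anti; rewrite lev_modulus ler_modulus lev_refl andbT/=.
by apply: lev_trans (x0); rewrite -(oppr0 X) levN2.
Qed.

Lemma lev_modulusD x y z w :
  modulus x <=v z -> modulus y <=v w -> modulus (x + y) <=v z + w.
Proof.
by rewrite !lev_modulus opprD => /andP[? ?] /andP[? ?]; rewrite !levD.
Qed.

Lemma lev_modulusB x y z w :
  modulus x <=v z -> modulus y <=v w -> modulus (x - y) <=v z + w.
Proof. by move=> xz yw; apply: lev_modulusD => //; rewrite modulusN. Qed.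

Lemma lev_modulusZ t x z :
  modulus x <=v z -> modulus (t *: x) <=v `|t| *: z.
Proof.
rewrite !lev_modulus => /andP[xz nxz].
have [t0|/ltW t0] := leP 0 t.
  by rewrite ger0_norm// -scalerN !lev_wpZ2l.
rewrite ler0_norm//; have -> : t *: x = - t *: - x.
  by rewrite scalerN scaleNr opprK.
by rewrite -scalerN opprK !lev_wpZ2l ?oppr_ge0.
Qed.

End VectorLatticeTheory.

(** Supplies the limits of the series of majorants, of coefficients and of regulators below; the
    factor 2 is the sum of the powers of 1/2. *)
Lemma geometric_series_cvg (R : realType) (V : completeNormedModType R)
    (u : nat -> V) (C : R) :
  (forall k, `|u k| <= C * 2^-1 ^+ k) ->
  exists2 l, series u @ \oo --> l & `|l| <= C * 2.
Proof.
move=> uC.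
have half1 : `|2^-1 : R| < 1 by rewrite ger0_norm ?invr_ge0// invf_lt1// ltr1n.
have C2 : C / (1 - 2^-1) = C * 2 :> R.
  by rewrite (_ : 1 - 2^-1 = 2^-1 :> R) ?invrK//; lra.
have gC := cvg_geometric_series half1 (a := C).
have ncvg : cvgn [normed series u].
  apply: (@series_le_cvg _ _ (geometric C 2^-1)) => [n|n|//|].
  - exact: normr_ge0.
  - exact: le_trans (normr_ge0 _) (uC n).
  - by apply/cvg_ex; eexists; exact: gC.
exists (limn (series u)); first exact: normed_cvg.
apply: le_trans (lim_series_norm ncvg) _.
rewrite -C2 -(cvg_lim _ gC)//; apply: lim_series_le => //.
by apply/cvg_ex; eexists; exact: gC.
Qed.

(** * Interplay of norm and order in a Banach lattice *)

Section BanachLatticeTheory.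
Variables (R : realType) (X : banachLatticeType R).
Implicit Types (x y z w : X) (u : nat -> X).

Lemma norm_modulus x : `|modulus x| = `|x|.
Proof.
apply/eqP; rewrite eq_le !ler_norm_modulus//.
  by rewrite (ge0_modulus (modulus_ge0 x)) lev_refl.
by rewrite (ge0_modulus (modulus_ge0 x)) lev_refl.
Qed.

Lemma lev_norm x y : 0 <=v x -> x <=v y -> `|x| <= `|y|.
Proof.
move=> x0 xy; apply: ler_norm_modulus; rewrite !ge0_modulus//.
exact: lev_trans xy.
Qed.

(** The positive part [joinv w 0] lies between 0 and [modulus y], so its norm is at most every [eps]
    and it vanishes. Norm estimates enter the computation of infima this way. *)
Lemma lev0_approx w :
  (forall eps : R, 0 < eps -> exists2 y, w <=v y & `|y| < eps) -> w <=v 0.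
Proof.
move=> h; suff /normr0_eq0 <- : `|joinv w 0| = 0 by exact: joinv_ubl.
apply/eqP; rewrite eq_le normr_ge0 andbT.
apply/ler_addgt0Pr => eps /h[y wy yeps].
rewrite add0r.
apply: le_trans (ltW yeps); rewrite -(norm_modulus y); apply: lev_norm.
  exact: joinv_ubr.
by rewrite levUx modulus_ge0 andbT; apply: lev_trans wy (ler_modulus y).
Qed.

(** Eventually x - w <= x - u_n, and the right-hand side is small in norm. *)
Lemma lev_lim u x w :
  u @ \oo --> x -> (\forall n \near \oo, u n <=v w) -> x <=v w.
Proof.
move=> /cvgrPdist_lt ux uw; rewrite -subv_le0.
apply: lev0_approx => eps /ux ueps.
have [n [uxn uwn]] := filter_ex (filterI ueps uw).
by exists (x - u n) => //; rewrite lev_wD2l// levN2.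
Qed.

Lemma lev_modulus_lim u x w : u @ \oo --> x ->
  (\forall n \near \oo, modulus (u n) <=v w) -> modulus x <=v w.
Proof.
move=> ux uw; rewrite lev_modulus; apply/andP; split.
  apply: lev_lim ux _.
  by apply: filterS uw => n; rewrite lev_modulus => /andP[].
apply: (lev_lim (u := fun n => - u n)); first exact: cvgN.
by apply: filterS uw => n; rewrite lev_modulus => /andP[].
Qed.

Lemma lev_series u l :
  (forall n, 0 <=v u n) -> series u @ \oo --> l -> forall n, series u n <=v l.
Proof.
move=> u0 ul n; rewrite -levN2.
apply: (lev_lim (u := fun n => - series u n)); first exact: cvgN.
exists n => // m /= nm; rewrite levN2 -(subnK nm).
elim: (m - n)%N => [|d IH]; first exact: lev_refl.
by apply: lev_trans IH _; rewrite addSn seriesSr -[X in X <=v _]addr0 lev_wD2l.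
Qed.

Lemma lev_series_term u l :
  (forall n, 0 <=v u n) -> series u @ \oo --> l -> forall n, u n <=v l.
Proof.
move=> u0 ul n; apply: lev_trans (lev_series u0 ul n.+1).
rewrite seriesSr -[X in X <=v _]add0r lev_wD2r//.
elim: n => [|n IH]; first by rewrite /series/= big_geq// lev_refl.
by rewrite seriesSr -[0]addr0 levD.
Qed.

End BanachLatticeTheory.

(** * Stability of sigma-order convergence, and its comparison with uniform convergence *)

Section SigmaOrder.
Variables (R : realType) (X : banachLatticeType R).
Implicit Types (x y z w : X) (u v : nat -> X).

(** Finite meets along an enumeration of [I] decrease, still dominate eventually, and have infimum
    0. Regulators may thus be indexed by pairs, with no care for monotonicity. *)
Lemma sigma_order_cvg_family (I : countType) (i0 : I) (y : I -> X) u x :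
  (forall w, (forall i, w <=v y i) -> w <=v 0) ->
  (forall i, \forall n \near \oo, modulus (u n - x) <=v y i) ->
  sigma_order_cvg u x.
Proof.
move=> y_inf y_dom.
(* Numbers that decode to no index are sent to [i0]. *)
pose f k := y (odflt i0 (unpickle k)).
pose z := fix z k := if k is k'.+1 then meetv (z k') (f k) else f 0%N.
have zS k : z k.+1 = meetv (z k) (f k.+1) by [].
have zf k : z k <=v f k.
  by case: k => [|k]; rewrite ?zS; [exact: lev_refl|exact: meetv_lbr].
have z_dom m : \forall n \near \oo, modulus (u n - x) <=v z m.
  elim: m => [|m IH]; first exact: y_dom.
  rewrite zS; apply: filterS2 IH (y_dom (odflt i0 (unpickle m.+1))) => n zm fm.
  by rewrite levxI zm.
exists z; split => //.
- by move=> m; rewrite zS meetv_lbl.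
- move=> m; have [n] := filter_ex (z_dom m).
  by apply: lev_trans; exact: modulus_ge0.
- move=> w wz; apply: y_inf => i; apply: lev_trans (wz (pickle i)) _.
  by apply: lev_trans (zf _) _; rewrite /f pickleK lev_refl.
Qed.

Lemma sigma_order_cvgD u v x y :
  sigma_order_cvg u x -> sigma_order_cvg v y ->
  sigma_order_cvg (fun n => u n + v n) (x + y).
Proof.
move=> [z [_ _ z_inf z_dom]] [t [_ _ t_inf t_dom]].
apply: (@sigma_order_cvg_family (nat * nat)%type (0, 0)%N
  (fun i => z i.1 + t i.2)) => [w wzt|[i j]].
  apply: z_inf => i; rewrite -subv_le0; apply: t_inf => j.
  by rewrite lev_subl_addr addrC; exact: (wzt (i, j)).
near=> n; rewrite opprD addrACA; apply: lev_modulusD.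
  by near: n; exact: z_dom.
by near: n; exact: t_dom.
Unshelve. all: by end_near. Qed.

Lemma sigma_order_cvgZ (t : R) u x :
  sigma_order_cvg u x -> sigma_order_cvg (fun n => t *: u n) (t *: x).
Proof.
move=> [z [_ _ z_inf z_dom]].
apply: (@sigma_order_cvg_family nat 0%N (fun i => `|t| *: z i)) => [w wz|i].
  (* For [t = 0] the family is constantly 0; otherwise divide by |t|. *)
  have [t0|t0] := eqVneq t 0.
    by have := wz 0%N; rewrite t0 normr0 scale0r.
  have t_gt0 : 0 < `|t| by rewrite normr_gt0.
  have /z_inf : forall m, `|t|^-1 *: w <=v z m.
    move=> m; rewrite -[z m]scale1r -(mulVf (lt0r_neq0 t_gt0)) -scalerA.
    by rewrite lev_wpZ2l// invr_ge0 normr_ge0.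
  move/(lev_wpZ2l (ltW t_gt0)).
  by rewrite scalerA divff ?lt0r_neq0// scale1r scaler0.
by apply: filterS (z_dom i) => n; rewrite -scalerBr; exact: lev_modulusZ.
Qed.

Lemma sigma_order_cvg_near_cst u x :
  (\forall n \near \oo, u n = x) -> sigma_order_cvg u x.
Proof.
move=> ux.
apply: (@sigma_order_cvg_family nat 0%N (fun=> 0)) => [w /(_ 0%N)//|_].
by apply: filterS ux => n ->; rewrite subrr ge0_modulus lev_refl.
Qed.

(** Split |u - x| into |u - u_k|, |u_k - x_k| and |x_k - x|, with regulators indexed by pairs (k,
    m). The infimum over [m] removes the middle term, and letting [k] grow removes the other two in
    norm. *)
Lemma sigma_order_cvg_approx (u_ : nat -> nat -> X) (x_ v : nat -> X) u x :
  (forall k, sigma_order_cvg (u_ k) (x_ k)) ->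
  (forall k n, modulus (u n - u_ k n) <=v v k) ->
  v @ \oo --> (0 : X) -> x_ @ \oo --> x ->
  sigma_order_cvg u x.
Proof.
move=> u_x_ uv v0 x_x.
have /choice[z z_] k := u_x_ k.
pose y i := v i.1 + z i.1 i.2 + modulus (x_ i.1 - x).
apply: (@sigma_order_cvg_family (nat * nat)%type (0, 0)%N y) => [w wy|[k m]].
  have {}wy k : w <=v v k + modulus (x_ k - x).
    have [_ _ z_inf _] := z_ k.
    rewrite -subv_le0; apply: z_inf => m.
    by rewrite lev_subl_addr addrA [z k m + _]addrC; exact: (wy (k, m)).
  apply: lev0_approx => eps eps0.
  have eps2 : 0 < eps / 2 by rewrite divr_gt0.
  have /cvgrPdist_lt/(_ _ eps2) v_eps := v0.
  have /cvgrPdist_lt/(_ _ eps2) x_eps := x_x.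
  have [k [vk xk]] := filter_ex (filterI v_eps x_eps).
  exists (v k + modulus (x_ k - x)) => //.
  apply: le_lt_trans (ler_normD _ _) _.
  rewrite (splitr eps) norm_modulus distrC ltrD//.
  by move: vk; rewrite sub0r normrN.
have [_ _ _ z_dom] := z_ k.
apply: filterS (z_dom m) => n uzn.
have -> : u n - x = u n - u_ k n + (u_ k n - x_ k) + (x_ k - x).
  by rewrite !addrA !subrK.
by apply: lev_modulusD; [exact: lev_modulusD|exact: lev_refl].
Qed.

Lemma uniform_sigma_order_cvg u x : uniform_cvg u x -> sigma_order_cvg u x.
Proof.
move=> [z z0 uz].
(* The shift to [m.+1] avoids the inverse of 0. *)
apply: (@sigma_order_cvg_family nat 0%N (fun m => m.+1%:R^-1 *: z)) => [w wz|m].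
  apply: lev0_approx => eps eps0.
  have [m] : exists m : nat, m.+1%:R^-1 * `|z| < eps.
    exists (Num.truncn (`|z| / eps)).
    by rewrite mulrC ltr_pdivrMr// mulrC -ltr_pdivrMr// truncnS_gt.
  by exists (m.+1%:R^-1 *: z) => //; rewrite normrZ gtr0_norm ?invr_gt0 ?ltr0n.
exact: uz.
Qed.

(** The tail is bounded by z_0 + |x|; joins of moduli absorb the finitely many earlier terms. *)
Lemma sigma_order_cvg_bounded u x : sigma_order_cvg u x ->
  exists w, forall n, modulus (u n) <=v w.
Proof.
move=> [z [_ _ _ /(_ 0%N)[N _ uz]]].
pose s := fix s k := if k is k'.+1 then joinv (s k') (modulus (u k')) else 0.
have s_dom k n : (n < k)%N -> modulus (u n) <=v s k.
  elim: k => // k IH; rewrite ltnS leq_eqVlt => /predU1P[->|/IH].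
    exact: joinv_ubr.
  by move=> /lev_trans; apply; exact: joinv_ubl.
exists (joinv (s N) (z 0%N + modulus x)) => n.
have [/uz/= uzn|/s_dom] := leqP N n; last first.
  by move=> /lev_trans; apply; exact: joinv_ubl.
apply: lev_trans (joinv_ubr _ _); rewrite -[u n](subrK x).
by apply: lev_modulusD => //; exact: lev_refl.
Qed.

End SigmaOrder.

(** * Expansions with order-bounded partial sums *)

Section BoundedExpansion.
Variables (R : realType) (X : banachLatticeType R) (e : nat -> X).
Implicit Types (x y w : X) (a b : nat -> R) (C M N t : R).

Local Notation psum a := (series (fun k => a k *: e k)).

Lemma psumD a b :
  psum (fun k => a k + b k) = fun n => psum a n + psum b n.
Proof.
apply/funext => n; rewrite /series/= -big_split.
by apply: eq_bigr => k _; rewrite scalerDl.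
Qed.

Lemma psumZ t a : psum (fun k => t * a k) = fun n => t *: psum a n.
Proof.
apply/funext => n; rewrite /series/= scaler_sumr.
by apply: eq_bigr => k _; rewrite scalerA.
Qed.

Lemma psum_truncated m a : \forall n \near \oo,
  psum (fun k => if (k < m)%N then a k else 0) n = \sum_(k < m) a k *: e k.
Proof.
exists m => // n /= mn.
rewrite /series/= (big_cat_nat (n := m))//= [X in _ + X]big_nat_cond.
rewrite [X in _ + X]big1 ?addr0; last first.
  by move=> k /andP[/andP[mk _] _]; rewrite ltnNge mk/= scale0r.
by rewrite big_mkord; apply: eq_bigr => k _; rewrite ltn_ord.
Qed.

Lemma sigma_order_expansionD a b x y :
  sigma_order_expansion e a x -> sigma_order_expansion e b y ->
  sigma_order_expansion e (fun k => a k + b k) (x + y).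
Proof.
move=> ax bx; rewrite /sigma_order_expansion.
rewrite psumD.
exact: sigma_order_cvgD.
Qed.

Lemma sigma_order_expansionZ t a x :
  sigma_order_expansion e a x ->
  sigma_order_expansion e (fun k => t * a k) (t *: x).
Proof.
move=> ax; rewrite /sigma_order_expansion.
rewrite psumZ.
exact: sigma_order_cvgZ.
Qed.

(** As a set of vectors [x], this plays the role of the image of the ball of radius [N] in the open
    mapping theorem. *)
Definition bounded_expansion N x := exists a w,
  [/\ sigma_order_expansion e a x, forall n, modulus (psum a n) <=v w &
      `|w| <= N].

(** The bound is an integer so that countably many sets cover X in the Baire argument. *)
Lemma bounded_expansion_exists a x : sigma_order_expansion e a x ->
  exists N : nat, bounded_expansion N%:R x.
Proof.
move=> ax; have [w aw] := sigma_order_cvg_bounded ax.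
exists (Num.truncn `|w|).+1, a, w; split => //.
by rewrite ltW// truncnS_gt.
Qed.

Lemma bounded_expansionD M N x y :
  bounded_expansion M x -> bounded_expansion N y ->
  bounded_expansion (M + N) (x + y).
Proof.
move=> [a [w [ax aw wM]]] [b [z [bY bz zN]]].
exists (fun k => a k + b k), (w + z); split.
- exact: sigma_order_expansionD.
- move=> n; rewrite psumD.
  exact: lev_modulusD.
- by apply: le_trans (ler_normD _ _) _; exact: lerD.
Qed.

Lemma bounded_expansionZ t N x :
  bounded_expansion N x -> bounded_expansion (`|t| * N) (t *: x).
Proof.
move=> [a [w [ax aw wN]]].
exists (fun k => t * a k), (`|t| *: w); split.
- exact: sigma_order_expansionZ.
- move=> n; rewrite psumZ.
  exact: lev_modulusZ.
- by rewrite normrZ normr_id ler_wpM2l.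
Qed.

(** [a i *: e i] is the difference of two consecutive partial sums. Where [e i] is non-zero, the
    majorant thus controls the coefficient. *)
Lemma coef_bound a w : (forall n, modulus (psum a n) <=v w) ->
  forall i, `|a i| * `|e i| <= 2 * `|w|.
Proof.
move=> aw i.
have w0 : 0 <=v w := lev_trans _ _ _ (modulus_ge0 _) (aw 0%N).
have psum_le n : `|psum a n| <= `|w|.
  by apply: ler_norm_modulus; rewrite (ge0_modulus w0).
rewrite -normrZ (_ : a i *: e i = psum a i.+1 - psum a i).
  by rewrite mulr_natl mulr2n; apply: le_trans (ler_normB _ _) _; rewrite lerD.
by rewrite seriesSr addrAC subrr add0r.
Qed.

(** Completeness of the sequence space: expansions of the terms are added coefficientwise, and the
    tails of the series of majorants control the error in all partial sums at once. *)
Lemma bounded_expansion_series C (x_ : nat -> X) x :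
  (forall n, e n != 0) ->
  (forall k, bounded_expansion (C * 2^-1 ^+ k) (x_ k)) ->
  series x_ @ \oo --> x -> bounded_expansion (C * 2) x.
Proof.
move=> e_neq0 /choice[a /choice[z az]] x_x.
have ax k : sigma_order_expansion e (a k) (x_ k) by have [] := az k.
have a_dom k n : modulus (psum (a k) n) <=v z k by have [_ + _] := az k; apply.
have zC k : `|z k| <= C * 2^-1 ^+ k by have [] := az k.
have z0 k : 0 <=v z k := lev_trans _ _ _ (modulus_ge0 _) (a_dom k 0%N).
have [Z zZ ZC] := geometric_series_cvg zC.
(* By [coef_bound] and [e i != 0], each coefficient series is dominated by a geometric one. *)
have /choice[b ab] i : exists bi : R, series (a ^~ i) @ \oo --> bi.
  have aC k : `|a k i| <= 2 * C / `|e i| * 2^-1 ^+ k.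
    rewrite mulrAC ler_pdivlMr ?normr_gt0//.
    by apply: le_trans (coef_bound (a_dom k) i) _; rewrite -mulrA ler_wpM2l.
  by have [bi] := @geometric_series_cvg R R^o (a ^~ i) _ aC; exists bi.
(* The [n]-th partial sum of the expansion of [series x_ K]. *)
pose S K n := \sum_(0 <= k < K) psum (a k) n.
have S_cvg n : S ^~ n @ \oo --> psum b n.
  rewrite (_ : S ^~ n = fun K => \sum_(0 <= i < n) series (a ^~ i) K *: e i).
    elim: n => [|n IH].
      rewrite /series/= big_geq//; under eq_fun do rewrite big_geq//.
      exact: cvg_cst.
    rewrite seriesSr; under eq_fun do rewrite big_nat_recr//=.
    by apply: cvgD => //; apply: cvgZr_tmp; exact: ab.
  apply/funext => K; rewrite /S /series/= exchange_big/=.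
  by apply: eq_bigr => i _; rewrite scaler_suml.
have S_tail K d n :
    modulus (S (K + d)%N n - S K n) <=v series z (K + d)%N - series z K.
  elim: d => [|d IH].
    by rewrite addn0 !subrr ge0_modulus lev_refl.
  rewrite addnS seriesSr {1}/S big_nat_recr//= -!/(S _ _).
  rewrite addrAC [_ + z _ - _]addrAC.
  exact: lev_modulusD.
(* Let [K + d] tend to infinity in [S_tail] with [n] fixed; the bound does not depend on [n]. *)
have b_tail K n : modulus (psum b n - S K n) <=v Z - series z K.
  apply: (lev_modulus_lim (u := fun L => S L n - S K n)).
    by apply: cvgB; [exact: S_cvg|exact: cvg_cst].
  exists K => // L /= KL; rewrite -(subnKC KL).
  by apply: lev_trans (S_tail _ _ _) _; rewrite lev_wD2r// lev_series.
exists b, Z; split => //; last first.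
  (* The case [K = 0] bounds the partial sums themselves by [Z]. *)
  move=> n; have := b_tail 0%N n.
  by rewrite [S _ _]big_geq// [series z 0%N]big_geq// !subr0.
apply: (sigma_order_cvg_approx (u_ := S) (x_ := series x_)
  (v := fun K => Z - series z K)) => //.
- elim=> [|K IH].
    rewrite /series/= big_geq//; apply: sigma_order_cvg_near_cst.
    by apply: nearW => n; rewrite /S big_geq.
  rewrite seriesSr (_ : S K.+1 = fun n => S K n + psum (a K) n).
    by apply: sigma_order_cvgD IH _; exact: ax.
  by apply/funext => n; rewrite /S big_nat_recr.
- by rewrite -(subrr Z); apply: cvgB => //; exact: cvg_cst.
Qed.

(** * The open mapping argument: Baire category, then successive approximation *)

Lemma bounded_expansion_dense :
  (forall x, exists a, sigma_order_expansion e a x) ->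
  exists2 M, 0 <= M & forall x, exists2 p,
    bounded_expansion (M * `|x|) p & `|x - p| <= `|x| / 2.
Proof.
move=> ex_e.
pose A (N : nat) : set X := [set x | bounded_expansion N%:R x].
(* The sets [A N] cover X. If no closure contained a ball, the complements of the closures would be
   open and dense, and by Baire would share a point. *)
have [N [x0 [r r0 ballA]]] :
    exists (N : nat) x0, exists2 r : R, 0 < r & ball x0 r `<=` closure (A N).
  apply: contrapT => no_ball.
  have dense_A (N : nat) : open (~` closure (A N)) /\ dense (~` closure (A N)).
    split; first by rewrite openC; exact: closed_closure.
    move=> O [x Ox] Oo; apply: contrapT => OA; apply: no_ball.
    have /nbhs_ballP[r /= r0 rO] : nbhs x O by exact: open_nbhs_nbhs.
    exists N, x, r => // y /rO Oy; apply: contrapT => yA; apply: OA.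
    by exists y.
  have [] := Baire dense_A (O := setT); [by exists 0|exact: openT|].
  move=> x [_ xA]; have [a /bounded_expansion_exists[N xN]] := ex_e x.
  by apply: (xA N) => //; exact: subset_closure.
(* Both [x0 + y] and [x0] lie in the closure of [A N]; subtracting approximants moves the ball to
   the origin and doubles [N]. *)
have near_A y (eps : R) : 0 < eps -> `|y| < r -> exists2 p,
    bounded_expansion (N%:R + N%:R) p & `|y - p| < eps.
  move=> eps0 yr.
  have eps2 : 0 < eps / 2 by rewrite divr_gt0.
  have /(_ _ (nbhsx_ballx _ _ eps2))[p [pN]] : closure (A N) (x0 + y).
    by apply: ballA; rewrite -ball_normE/= opprD addNKr normrN.
  rewrite -ball_normE/= => yp.
  have /(_ _ (nbhsx_ballx _ _ eps2))[q [qN]] : closure (A N) x0.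
    exact/ballA/ballxx.
  rewrite -ball_normE/= => x0q.
  exists (p - q).
    apply: bounded_expansionD => //; rewrite -scaleN1r.
    by have := bounded_expansionZ (-1) qN; rewrite normrN1 mul1r.
  have -> : y - (p - q) = (x0 + y - p) - (x0 - q).
    rewrite [x0 + y]addrC -[y + x0 - p]addrA -addrA; congr (y + _).
    by rewrite !opprB [RHS]addrC addrA subrK.
  by apply: le_lt_trans (ler_normB _ _) _; rewrite (splitr eps) ltrD.
(* Scaling by t = 2|x| / r takes norm r/2 to |x|: the bound 2N becomes 2Nt, and the error r/4
   becomes |x|/2. *)
exists ((N%:R + N%:R) * (2 / r)) => [|x].
  by rewrite mulr_ge0 ?addr_ge0// divr_ge0// ltW.
(* The rescaling divides by |x|, so 0 is treated apart. *)
have [->|x_neq0] := eqVneq x 0.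
  exists 0; last by rewrite subrr normr0 mul0r.
  rewrite normr0 mulr0; exists (fun=> 0), 0.
  have psum0 n : psum (fun=> 0) n = 0.
    by rewrite /series/= big1// => i _; rewrite scale0r.
  rewrite normr0; split=> // [|n].
    exact/sigma_order_cvg_near_cst/nearW.
  by rewrite psum0 ge0_modulus lev_refl.
have x_gt0 : 0 < `|x| by rewrite normr_gt0.
pose t := 2 / r * `|x|.
have t0 : 0 < t by rewrite mulr_gt0 ?divr_gt0.
have tx : `|t^-1 *: x| < r.
  rewrite normrZ gtr0_norm ?invr_gt0// (_ : _ * _ = r / 2) ?ltr_pdivrMr//.
    by lra.
  by rewrite /t; field; rewrite !gt_eqF.
have r4 : 0 < r / 4 by rewrite divr_gt0.
have [p pN px] := near_A _ _ r4 tx.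
exists (t *: p).
  rewrite -mulrA mulrC -[X in X * _]gtr0_norm//; exact: bounded_expansionZ.
have -> : x - t *: p = t *: (t^-1 *: x - p).
  by rewrite scalerBr scalerA divff ?gt_eqF// scale1r.
rewrite normrZ gtr0_norm//.
apply: le_trans (ler_wpM2l (ltW t0) (ltW px)) _.
by rewrite (_ : t * (r / 4) = `|x| / 2)// /t; field; rewrite gt_eqF.
Qed.

Lemma bounded_expansion_le M N x :
  M <= N -> bounded_expansion M x -> bounded_expansion N x.
Proof.
by move=> MN [a [w [ax aw wM]]]; exists a, w; split => //; exact: le_trans MN.
Qed.

(** Each residual is approximated to within half its norm, so residuals decay like 2^-k, the
    approximants sum to [x], and their bounds are geometric; hence the constant doubles. *)
Lemma bounded_expansion_unif :
  (forall n, e n != 0) ->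
  (forall x, exists a, sigma_order_expansion e a x) ->
  exists2 M, 0 <= M & forall x, bounded_expansion (M * `|x|) x.
Proof.
move=> e_neq0 /bounded_expansion_dense[M M0 h].
have /choice[f fP] x : exists p,
    bounded_expansion (M * `|x|) p /\ `|x - p| <= `|x| / 2.
  by have [p] := h x; exists p.
exists (M * 2) => [|x]; first by rewrite mulr_ge0.
pose r k := iter k (fun y => y - f y) x.
have rC k : `|r k| <= `|x| * 2^-1 ^+ k.
  elim: k => [|k IH]; first by rewrite expr0 mulr1.
  rewrite exprSr mulrA; apply: le_trans (fP (r k)).2 _.
  by rewrite ler_wpM2r// invr_ge0.
rewrite mulrAC; apply: (@bounded_expansion_series _ (f \o r)) => // [k|].
  apply: bounded_expansion_le (fP (r k)).1.
  by rewrite -mulrA ler_wpM2l.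
(* The sum of the first [k] approximants telescopes. *)
rewrite (_ : series _ = fun k => x - r k).
  rewrite -[x in _ --> x]subr0; apply: cvgB; first exact: cvg_cst.
  apply: norm_cvg0.
  apply: (squeeze_cvgr (f := fun=> 0) (h := geometric `|x| 2^-1)).
  - by apply: nearW => k; rewrite normr_ge0 rC.
  - exact: cvg_cst.
  - by apply: cvg_geometric; rewrite ger0_norm ?invr_ge0// invf_lt1// ltr1n.
apply/funext; elim => [|k IH].
  by rewrite /r/= subrr /series/= big_geq.
by rewrite seriesSr IH /r/= opprB [f _ - _]addrC addrA.
Qed.

(** * From sigma-order to uniform convergence *)

Lemma sigma_order_basis_uniform_expansion a x :
  (forall n, e n != 0) -> closed_span e = [set: X] -> sigma_order_basis e ->
  sigma_order_expansion e a x -> uniform_expansion e a x.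
Proof.
move=> e_neq0 e_span e_basis ax.
have [M M0 M_unif] :
    exists2 M, 0 <= M & forall x, bounded_expansion (M * `|x|) x.
  by apply: bounded_expansion_unif => // y; have [b []] := e_basis y; exists b.
(* The rate 4^-k leaves room for the weights 2^k of the regulator. *)
have quarter k : 0 < 4^-1 ^+ k :> R by rewrite exprn_gt0.
have approx k : exists w,
    `|w| <= (M + 1) * 4^-1 ^+ k /\
    \forall n \near \oo, modulus (psum a n - x) <=v w.
  have : closed_span e x by rewrite e_span.
  move=> /(_ _ (nbhsx_ballx _ _ (quarter k)))[y [[m [b yb]]]].
  rewrite -ball_normE/= => xy.
  have [c [w [cx cw wM]]] := M_unif (x - y).
  pose b' i := if (i < m)%N then b i else 0.
  have b'y : \forall n \near \oo, psum b' n = y.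
    by rewrite yb; exact: psum_truncated.
  (* Both sides expand x = (x - y) + y, so uniqueness equates them. *)
  have a_def : a = fun i => c i + b' i.
    have [a' [_ a'_uniq]] := e_basis x.
    rewrite -(a'_uniq a ax); apply: a'_uniq; rewrite -[x](subrK y).
    by apply: sigma_order_expansionD => //; exact: sigma_order_cvg_near_cst.
  exists (w + modulus (x - y)); split.
    apply: le_trans (ler_normD _ _) _; rewrite norm_modulus mulrDl mul1r.
    by rewrite lerD ?(ltW xy)//; apply: le_trans wM _; rewrite ler_wpM2l// ltW.
  (* Once S_n(b') = y, the difference S_n(a) - x is S_n(c) - (x - y). *)
  apply: filterS b'y => n b'n; rewrite a_def psumD b'n -addrA -opprB.
  by apply: lev_modulusB => //; exact: lev_refl.
have /choice[w w_dom] := approx.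
have w0 k : 0 <=v w k.
  have [n] := filter_ex (w_dom k).2.
  by apply: lev_trans; exact: modulus_ge0.
have [k|z wz _] := @geometric_series_cvg R X (fun k => 2 ^+ k *: w k) (M + 1).
  rewrite normrZ ger0_norm ?exprn_ge0//.
  rewrite (le_trans (ler_wpM2l _ (w_dom k).1)) ?exprn_ge0//.
  by rewrite mulrCA -exprMn (_ : 2 * 4^-1 = 2^-1)//; lra.
have w0' k : 0 <=v 2 ^+ k *: w k by rewrite scalev_ge0 ?exprn_ge0.
have z0 : 0 <=v z by exact: lev_trans (w0' 0%N) (lev_series_term w0' wz 0%N).
(* Since 2^m w_m is a term of the series, w_m <= 2^-m z <= z/m. *)
exists z => // m m0; apply: filterS (w_dom m).2 => n anw.
apply: lev_trans anw _.
have -> : w m = (2 ^+ m)^-1 *: (2 ^+ m *: w m).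
  by rewrite scalerA mulVf ?expf_neq0// scale1r.
apply: (@lev_trans _ _ ((2 ^+ m)^-1 *: z)).
  by rewrite lev_wpZ2l ?invr_ge0 ?exprn_ge0// (lev_series_term w0' wz).
rewrite lev_wpZ2r// lef_pV2 ?posrE ?exprn_gt0 ?ltr0n//.
by rewrite -natrX ler_nat ltnW// ltn_expl.
Qed.

End BoundedExpansion.

Theorem corollary1p5 (R : realType) (X : banachLatticeType R) (e : nat -> X) :
  analytic_determinacy ->
  (forall n, e n != 0) ->
  closed_span e = [set: X] ->
  sigma_order_basis e <->
  uniform_basis e /\
  (forall a : nat -> R, sigma_order_expansion e a 0 -> forall n, a n = 0).
Proof.
move=> _ e_neq0 e_span; split=> [e_basis|[e_unif e_zero]].
  have uniq x a b : sigma_order_expansion e a x ->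
      sigma_order_expansion e b x -> a = b.
    by have [c [_ c_uniq]] := e_basis x => /c_uniq <- /c_uniq.
  split=> [x|a a0 n].
    have [a [ax _]] := e_basis x.
    exists a; split; first exact: sigma_order_basis_uniform_expansion.
    (* A uniform expansion is a sigma-order expansion, so uniqueness carries over. *)
    by move=> b /uniform_sigma_order_cvg; exact: uniq.
  have -> // : a = fun=> 0.
  apply: uniq a0 _; apply/sigma_order_cvg_near_cst/nearW => m.
  by rewrite /series/= big1// => i _; rewrite scale0r.
move=> x; have [a [ax _]] := e_unif x.
have {}ax : sigma_order_expansion e a x by exact: uniform_sigma_order_cvg.
(* The difference of two expansions of [x] expands 0, hence vanishes. *)
exists a; split=> // b bx; apply/funext => n.
have : sigma_order_expansion e (fun k => a k + -1 * b k) 0.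
  rewrite -(subrr x) -(scaleN1r x).
  by apply: sigma_order_expansionD => //; exact: sigma_order_expansionZ.
by move/e_zero/(_ n); rewrite mulN1r => /subr0_eq.
Qed.
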